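(* Let $LB$ be the objective-function value of a feasible solution of the integer D-optimality problem $$\max\Big\{\operatorname{ldet}\big(A^\top \operatorname{Diag}(x)A\big) : \mathbf{e}^\top x=s,\ l\le x\le u,\ x\in\mathbb{Z}^n\Big\},\qquad (\text{D-Opt})$$ and let $(\hat\Theta,\hat\nu,\hat\omega,\hat\tau)$, with $\hat\Theta\in\mathbb{S}^m$, $\hat\nu,\hat\omega\in\mathbb{R}^n$, $\hat\tau\in\mathbb{R}$, be a feasible solution, with objective value $\hat\zeta$, of the problem $$\begin{array}{ll}\min & -\operatorname{ldet}\Theta-\omega^\top l+\nu^\top u+\tau s-m\\ \text{s.t.} & \operatorname{diag}(A\Theta A^\top)+\omega-\nu-\tau\mathbf{e}=0,\\ & \Theta\succ 0,\ \nu\ge 0,\ \omega\ge 0.\end{array}$$ Then, for every optimal solution $x^\star$ of (D-Opt), we have $$x_k^\star\le l_k+\left\lfloor\frac{\hat\zeta-LB}{\hat\omega_k}\right\rfloor\quad\text{for all }k\in N\text{ such that }\hat\omega_k>0,$$ $$x_k^\star\ge u_k-\left\lfloor\frac{\hat\zeta-LB}{\hat\nu_k}\right\rfloor\quad\text{for all }k\in N\text{ such that }\hat\nu_k>0.$$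
   Context: $n$, $m$, $s$ are natural numbers with $s\ge m$, $N:=\{1,\dots,n\}$, and $A\in\mathbb{R}^{n\times m}$ has full column rank. The vectors $l,u\in\mathbb{Z}^n$ satisfy $0\le l<u$ (componentwise) and $\mathbf{e}^\top l\le s\le\mathbf{e}^\top u$, where $\mathbf{e}$ is the all-ones vector. $\mathbb{S}^m$ is the set of real symmetric $m\times m$ matrices. $\operatorname{ldet}$ denotes the logarithm of the determinant, with value $-\infty$ on singular positive-semidefinite matrices (if $LB=-\infty$, the right-hand floors are read as $+\infty$ and the inequalities are vacuous). $\operatorname{Diag}(x)$ is the diagonal matrix with diagonal $x$, and $\operatorname{diag}(X)$ is the vector of diagonal entries of $X$. *)

(* Defs.v *)
From HB Require Import structures.
From mathcomp Require Import all_boot all_order all_algebra.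
From mathcomp Require Import all_classical all_reals all_analysis.

Set Implicit Arguments.
Unset Strict Implicit.
Unset Printing Implicit Defensive.

Import Order.TTheory GRing.Theory Num.Theory.

Local Open Scope ring_scope.

(* [lne] is -oo at 0, so this is -oo on singular positive-semidefinite
   matrices. *)
Definition ldet (R : realType) (m : nat) (M : 'M[R]_m) : \bar R :=
  lne (\det M)%:E.

Definition posdefmx (R : realType) (m : nat) (M : 'M[R]_m) : Prop :=
  M \is symmetricmx /\
  forall v : 'cV[R]_m, v != 0 -> 0 < (v^T *m M *m v) 0 0.

(* Floor with value +oo at +oo, which occurs when the lower bound is -oo. *)
Definition efloor (R : realType) (x : \bar R) : \bar R :=
  match x with
  | r%:E%E => (Num.floor r)%:~R%:E%E
  | +oo%E => +oo%E
  | -oo%E => -oo%E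
  end.

Section DOptimality.
Variables (R : realType) (n m s : nat).
Variables (A : 'M[R]_(n, m)) (l u : 'cV[int]_n).

Definition dopt_feasible (x : 'cV[int]_n) : Prop :=
  \sum_i x i 0 = s%:Z /\ forall i, l i 0 <= x i 0 <= u i 0.

Definition dopt_obj (x : 'cV[int]_n) : \bar R :=
  ldet (A^T *m diag_mx (map_mx intr x)^T *m A).

Definition dopt_optimal (x : 'cV[int]_n) : Prop :=
  dopt_feasible x /\
  forall y, dopt_feasible y -> (dopt_obj y <= dopt_obj x)%E.

Definition dual_feasible (Theta : 'M[R]_m) (nu omega : 'cV[R]_n) (tau : R)
    : Prop :=
  [/\ \col_i (A *m Theta *m A^T) i i + omega - nu - tau *: const_mx 1 = 0,
      posdefmx Theta,
      forall i, 0 <= nu i 0 &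
      forall i, 0 <= omega i 0].

Definition dual_obj (Theta : 'M[R]_m) (nu omega : 'cV[R]_n) (tau : R)
    : \bar R :=
  (- ldet Theta
   + (- (\sum_i omega i 0 * (l i 0)%:~R) + \sum_i nu i 0 * (u i 0)%:~R
      + tau * s%:R - m%:R)%:E)%E.

End DOptimality.

(* Main.v *)
(* Weak duality: for positive definite M and Theta,
     ln det M + ln det Theta <= tr (M Theta) - m,
   and with M = A^T Diag(x) A, stationarity of the dual point turns this into
     sum_i omega_i (x_i - l_i) + nu_i (u_i - x_i) <= zeta - ldet M.
   At an optimal x the right-hand side is at most zeta - LB and every summand
   is nonnegative, so each one is at most zeta - LB; integrality of x gives the
   floors.  The log-determinant inequality is proved without spectral theory,
   by induction on m: a congruence makes Theta = diag(a, C), the corner b of M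
   only decreases when replaced by its Schur complement, and
   ln (a b) <= a b - 1. *)
Require Import Defs.
From HB Require Import structures.
From mathcomp Require Import all_boot all_order all_algebra.
From mathcomp Require Import all_classical all_reals all_analysis.
From mathcomp Require Import ring lra.

Import Order.TTheory GRing.Theory Num.Theory.

Local Open Scope ring_scope.

(** * Positive definite matrices, Schur complements and the log-determinant inequality *)

Section PositiveDefinite.
Context {R : realType}.

Lemma symmetricmxE (m : nat) (M : 'M[R]_m) :
  (M \is symmetricmx) = (M == M^T).
Proof. by rewrite is_hermitianmxE expr0 scale1r map_mx_id. Qed.

Lemma posdefmx_tr {m : nat} {M : 'M[R]_m} : posdefmx M -> M^T = M.
Proof. by case; rewrite symmetricmxE => /eqP/esym. Qed.

(** [U] may be rectangular, so that passing to a diagonal block is a congruence too, by a coordinate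
    inclusion. *)
Lemma posdefmx_congr {m p : nat} (U : 'M[R]_(m, p)) {M : 'M[R]_m} :
  (forall v : 'cV_p, v != 0 -> U *m v != 0) ->
  posdefmx M -> posdefmx (U^T *m M *m U).
Proof.
move=> injU pdM; split; last first.
  by move=> v /injU /pdM.2; rewrite trmx_mul !mulmxA.
by rewrite symmetricmxE !trmx_mul trmxK (posdefmx_tr pdM) mulmxA.
Qed.

Lemma posdefmx_congr_unit {m : nat} {U M : 'M[R]_m} :
  U \in unitmx -> posdefmx M -> posdefmx (U^T *m M *m U).
Proof.
move=> uU; apply: posdefmx_congr => v; apply: contra_neq => Uv0.
by rewrite -(mulKmx uU v) Uv0 mulmx0.
Qed.

Lemma posdefmx_unit {m : nat} {M : 'M[R]_m} : posdefmx M -> M \in unitmx.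
Proof.
move=> pdM; rewrite unitmxE unitfE; apply/negP => /det0P[v v0 vM0].
have /pdM.2 : v^T != 0 by rewrite trmx_eq0.
by rewrite trmxK vM0 mul0mx mxE ltxx.
Qed.

Lemma posdefmx_ulsub {p q : nat} {M : 'M[R]_(p + q)} :
  posdefmx M -> posdefmx (ulsubmx M).
Proof.
rewrite -{1}(submxK M) => /(posdefmx_congr (col_mx 1%:M 0)) pd.
have {pd} := pd _.
rewrite tr_col_mx mul_row_block mul_row_col.
rewrite !trmx1 !trmx0 !mul1mx !mul0mx !mulmx1 !mulmx0 !addr0; apply=> v v0.
by rewrite mul_col_mx mul1mx mul0mx col_mx_eq0 (negPf v0).
Qed.

Lemma posdefmx_drsub {p q : nat} {M : 'M[R]_(p + q)} :
  posdefmx M -> posdefmx (drsubmx M).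
Proof.
rewrite -{1}(submxK M) => /(posdefmx_congr (col_mx 0 1%:M)) pd.
have {pd} := pd _.
rewrite tr_col_mx mul_row_block mul_row_col.
rewrite !trmx1 !trmx0 !mul1mx !mul0mx !mulmx1 !mulmx0 !add0r; apply=> v v0.
by rewrite mul_col_mx mul1mx mul0mx col_mx_eq0 (negPf v0) andbF.
Qed.

Lemma posdefmx_quad_ge0 {m : nat} {M : 'M[R]_m} (v : 'cV_m) :
  posdefmx M -> 0 <= (v^T *m M *m v) 0 0.
Proof.
move=> pdM; have [->|/pdM.2/ltW//] := eqVneq v 0.
by rewrite mulmx0 mxE.
Qed.

Lemma posdefmx_inv {m : nat} {M : 'M[R]_m} : posdefmx M -> posdefmx (invmx M).
Proof.
move=> pdM; have uM := posdefmx_unit pdM.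
(* The inverse is itself a congruence of [M]: [invmx M = (invmx M)^T *m M *m invmx M]. *)
have := posdefmx_congr_unit (U := invmx M) _ pdM.
by rewrite unitmx_inv uM trmx_inv (posdefmx_tr pdM) mulVmx // mul1mx; apply.
Qed.

(** Block elimination: with [B] the upper-right and [D] the lower-right block, [S] is the Schur
    complement of [D] and [U] is unit upper triangular with corner [B *m invmx D]. The diagonal
    bound holds because the subtracted matrix has the form B D^-1 B^T. *)
Lemma posdefmx_schur {p q : nat} {M : 'M[R]_(p + q)} : posdefmx M ->
  exists (U : 'M[R]_(p + q)) (S : 'M[R]_p), [/\ \det U = 1,
    M = U *m block_mx S 0 0 (drsubmx M) *m U^T, posdefmx S &
    forall i, S i i <= ulsubmx M i i].
Proof.
move=> pdM; have pdD := posdefmx_drsub pdM.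
have uD := posdefmx_unit pdD; pose B := ursubmx M; have tD := posdefmx_tr pdD.
set D := drsubmx M in pdD uD tD *.
have defM : M = block_mx (ulsubmx M) B B^T D.
  rewrite -{1}(submxK M); congr block_mx.
  by rewrite /B trmx_ursub (posdefmx_tr pdM).
pose K := B *m invmx D; pose S := ulsubmx M - K *m B^T.
pose U : 'M[R]_(p + q) := block_mx 1%:M K 0 1%:M.
have detU : \det U = 1 by rewrite det_ublock !det1 mulr1.
have uU : U \in unitmx by rewrite unitmxE detU unitr1.
have KD : K *m D = B by rewrite mulmxKV.
have DK : D *m K^T = B^T by rewrite -{1}tD -trmx_mul KD.
have defM' : M = U *m block_mx S 0 0 D *m U^T.
  rewrite tr_block_mx !mulmx_block !trmx0 !trmx1.
  rewrite !(mul1mx, mul0mx, mulmx1, mulmx0, addr0, add0r) KD.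
  rewrite {1}defM; congr block_mx; last by rewrite -DK.
  by rewrite -KD -mulmxA DK subrK.
exists U, S; split => //.
(* [S] is the upper-left block of the congruence of [M] by [(invmx U)^T]. *)
- have uV : (invmx U)^T \in unitmx by rewrite unitmx_tr unitmx_inv.
  have := posdefmx_ulsub (posdefmx_congr_unit uV pdM).
  rewrite trmxK {1}defM' !mulmxA mulVmx // mul1mx -mulmxA -trmx_mul mulVmx //.
  by rewrite trmx1 mulmx1 block_mxKul.
- move=> i; have -> : S i i = ulsubmx M i i - (K *m B^T) i i.
    by rewrite mxE [in X in _ + X]mxE.
  rewrite lerBlDr lerDl.
  (* The i-th diagonal entry of [K *m B^T] is the quadratic form of [invmx D] at the i-th column of
     [B^T]. *)
  have := posdefmx_quad_ge0 (col i B^T) (posdefmx_inv pdD).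
  by rewrite tr_col trmxK -!row_mul mxE colE mulmxA -colE mxE.
Qed.

Lemma posdefmx_det_gt0 {m : nat} {M : 'M[R]_m} : posdefmx M -> 0 < \det M.
Proof.
elim: m M => [|m IHm]; first by move=> M; rewrite det_mx00.
change (forall M : 'M[R]_(1 + m), posdefmx M -> 0 < \det M) => M pdM.
have [U [S [detU -> pdS _]]] := posdefmx_schur pdM.
rewrite !det_mulmx det_tr detU mul1r mulr1 (@det_ublock _ 1).
apply: mulr_gt0; last exact: IHm (posdefmx_drsub pdM).
have := pdS.2 1%:M (oner_neq0 _).
by rewrite trmx1 mul1mx mulmx1 det_mx11.
Qed.

Lemma ln_det_le_trace {m : nat} {M T : 'M[R]_m} : posdefmx M -> posdefmx T ->
  ln (\det M) + ln (\det T) <= \tr (M *m T) - m%:R.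
Proof.
elim: m M T => [|m IHm].
  by move=> M T _ _; rewrite !det_mx00 ln1 subr0 addr0 [M *m T]flatmx0 mxtrace0.
change (forall M T : 'M[R]_(1 + m), posdefmx M -> posdefmx T ->
  ln (\det M) + ln (\det T) <= \tr (M *m T) - m.+1%:R) => M T pdM pdT.
have [U [a [detU defT pda _]]] := posdefmx_schur pdT.
set C := drsubmx _ in defT.
have pdC : posdefmx C := posdefmx_drsub pdT.
have uU : U \in unitmx by rewrite unitmxE detU unitr1.
(* Cyclicity of the trace moves [U] from [T] onto [M]; since [\det U = 1], determinants do not
   change. *)
pose N : 'M[R]_(1 + m) := U^T *m M *m U.
have pdN : posdefmx N := posdefmx_congr_unit uU pdM.
have [V [b [detV defN pdb leb]]] := posdefmx_schur pdN.
set D := drsubmx _ in defN.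
have pdD : posdefmx D := posdefmx_drsub pdN.
have detT : \det T = a 0 0 * \det C.
  rewrite defT !det_mulmx det_tr detU mul1r mulr1 (@det_ublock _ 1).
  by rewrite -det_mx11.
have detM : \det M = b 0 0 * \det D.
  have <- : \det N = \det M.
    by rewrite !det_mulmx det_tr detU mul1r mulr1.
  rewrite defN !det_mulmx det_tr detV mul1r mulr1 (@det_ublock _ 1).
  by rewrite -det_mx11.
(* Against a block diagonal factor only the diagonal blocks of [N] reach the trace. The trace sees
   the corner of [N], the determinant sees [b]; [leb] compares them. *)
have trMT : \tr (M *m T) = ulsubmx N 0 0 * a 0 0 + \tr (D *m C).
  rewrite defT mulmxA mxtrace_mulC !mulmxA -/N -{1}(submxK N) mulmx_block.
  rewrite mxtrace_block !mulmx0 addr0 add0r; congr (_ + _).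
  by rewrite trace_mx11 mxE big_ord1.
have a0 : 0 < a 0 0 by rewrite -det_mx11 posdefmx_det_gt0.
have b0 : 0 < b 0 0 by rewrite -det_mx11 posdefmx_det_gt0.
have C0 := posdefmx_det_gt0 pdC; have D0 := posdefmx_det_gt0 pdD.
have hab : ln (b 0 0) + ln (a 0 0) <= ulsubmx N 0 0 * a 0 0 - 1.
  rewrite -lnM ?posrE//.
  have ba0 := mulr_gt0 b0 a0.
  have : ln (1 + (b 0 0 * a 0 0 - 1)) <= b 0 0 * a 0 0 - 1.
    by apply: le_ln1Dx; lra.
  rewrite [1 + _]addrC subrK => /le_trans; apply.
  by rewrite lerD2r ler_pM2r// leb.
have := IHm _ _ pdD pdC.
rewrite detM detT trMT !lnM ?posrE// -natr1; lra.
Qed.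

End PositiveDefinite.

(** * Weighted Gram matrices, weak duality and integer rounding *)

Section DOptimalityBound.
Context {R : realType} {n m : nat}.
Implicit Types (A : 'M[R]_(n, m)) (l u x : 'cV[int]_n).

(** The quadratic form at [v] is a sum of terms d_i (A v)_i^2. If it vanishes, so does each d_i (A
    v)_i, which puts [v] in the kernel of an invertible matrix. *)
Lemma posdefmx_weighted_gram A (d : 'rV[R]_n) : (forall i, 0 <= d 0 i) ->
  A^T *m diag_mx d *m A \in unitmx -> posdefmx (A^T *m diag_mx d *m A).
Proof.
move=> d0 uM; split.
  by rewrite symmetricmxE !trmx_mul trmxK tr_diag_mx mulmxA.
move=> v v0; pose w := A *m v.
have -> : (v^T *m (A^T *m diag_mx d *m A) *m v) 0 0
    = \sum_i d 0 i * w i 0 ^+ 2.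
  rewrite -!mulmxA -/w mulmxA -trmx_mul -/w mul_diag_mx mxE.
  by apply: eq_bigr => i _; rewrite !mxE mulrCA -expr2.
have t0 i : true -> 0 <= d 0 i * w i 0 ^+ 2.
  by move=> _; rewrite mulr_ge0 ?d0 ?sqr_ge0.
rewrite lt_def sumr_ge0// andbT; apply: contra_neq v0 => /eqP.
rewrite psumr_eq0// => /allP dw0.
have Dw0 : diag_mx d *m w = 0.
  apply/matrixP => i j; rewrite mul_diag_mx mxE [RHS]mxE ord1.
  have := dw0 i (mem_index_enum i).
  by rewrite implyTb mulf_eq0 expf_eq0 -mulf_eq0 => /eqP.
by rewrite -(mulKmx uM v) -!mulmxA -/w Dw0 !mulmx0.
Qed.

Lemma trace_weighted_gram A (d : 'rV[R]_n) (T : 'M[R]_m) :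
  \tr (A^T *m diag_mx d *m A *m T) = \sum_i d 0 i * (A *m T *m A^T) i i.
Proof.
rewrite -!mulmxA mxtrace_mulC -!mulmxA mul_diag_mx.
by apply: eq_bigr => i _; rewrite mxE mulmxA.
Qed.

Lemma weak_duality {A s l u x Theta nu omega tau} :
  (forall i, 0 <= l i 0) ->
  dopt_feasible s l u x -> dual_feasible A Theta nu omega tau ->
  ((\sum_i (omega i 0 * (x i 0 - l i 0)%:~R
            + nu i 0 * (u i 0 - x i 0)%:~R))%:E
   <= dual_obj s l u Theta nu omega tau - dopt_obj A x)%E.
Proof.
move=> l0 [sumx lxu] [stat pdT nu0 omega0].
have T0 := posdefmx_det_gt0 pdT.
rewrite /dual_obj /dopt_obj /ldet lne_EFin//.
(* If the determinant is not positive, [ldet] is -oo and the right-hand side is +oo. *)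
set M := A^T *m _ *m A; have [M0|M0] := leP (\det M) 0.
  by rewrite /lne M0 leey.
have pdM : posdefmx M.
  apply: posdefmx_weighted_gram; last by rewrite unitmxE unitfE gt_eqF.
  move=> i; rewrite !mxE ler0z (le_trans (l0 i))//.
  by case/andP: (lxu i).
have := ln_det_le_trace pdM pdT.
rewrite lne_EFin// -!EFinN -!EFinD lee_fin trace_weighted_gram.
(* Stationarity gives the diagonal entries as nu_i - omega_i + tau; the weights sum to [s], so the
   tau terms collect to [tau * s%:R]. *)
have -> : \sum_i (map_mx intr x)^T 0 i * (A *m Theta *m A^T) i i
    = \sum_i (x i 0)%:~R * (nu i 0 - omega i 0) + tau * s%:R.
  have -> : s%:R = \sum_i (x i 0)%:~R :> R.
    by rewrite -rmorph_sum sumx.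
  rewrite mulr_sumr -big_split; apply: eq_bigr => i _.
  move: (A *m Theta *m A^T) stat => Q /(congr1 (fun B : 'cV[R]_n => B i 0)).
  rewrite !mxE mulr1 /= => stat_i.
  have -> : Q i i = nu i 0 - omega i 0 + tau by lra.
  by rewrite mulrDr [tau * _]mulrC.
have -> : \sum_i (omega i 0 * (x i 0 - l i 0)%:~R
                  + nu i 0 * (u i 0 - x i 0)%:~R)
    = - (\sum_i omega i 0 * (l i 0)%:~R) + \sum_i nu i 0 * (u i 0)%:~R
      - \sum_i (x i 0)%:~R * (nu i 0 - omega i 0).
  rewrite -!sumrN -!big_split /=; apply: eq_bigr => i _.
  by rewrite !rmorphB /=; ring.
lra.
Qed.

Lemma intr_le_efloor {y : \bar R} {j : int} :
  (j%:~R%:E <= y)%E -> (j%:~R%:E <= efloor y)%E.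
Proof. by case: y => //= r; rewrite !lee_fin ler_int floor_ge_int. Qed.

Lemma le_efloor_div {G : \bar R} {w : R} {j : int} : 0 < w ->
  ((w * j%:~R)%:E <= G)%E -> (j%:~R%:E <= efloor (G / w%:E))%E.
Proof.
move=> w0 wjG; apply: intr_le_efloor.
by rewrite inver gt_eqF// lee_pdivlMr// -EFinM mulrC.
Qed.

End DOptimalityBound.

Theorem theorem1 (R : realType) (n m s : nat) (A : 'M[R]_(n, m))
    (l u : 'cV[int]_n) (LB zeta : \bar R)
    (Theta : 'M[R]_m) (nu omega : 'cV[R]_n) (tau : R)
    (hms : (m <= s)%N)
    (hA : \rank A = m)
    (hl : forall i, 0 <= l i 0)
    (hlu : forall i, l i 0 < u i 0)
    (hls : \sum_i l i 0 <= s%:Z)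
    (hsu : s%:Z <= \sum_i u i 0)
    (hLB : exists2 x : 'cV[int]_n, dopt_feasible s l u x & LB = dopt_obj A x)
    (hdual : dual_feasible A Theta nu omega tau)
    (hzeta : zeta = dual_obj s l u Theta nu omega tau)
    (xstar : 'cV[int]_n) (hopt : dopt_optimal s A l u xstar) :
  (forall k : 'I_n, 0 < omega k 0 ->
     ((xstar k 0)%:~R%:E
      <= (l k 0)%:~R%:E + efloor ((zeta - LB) / (omega k 0)%:E))%E) /\
  (forall k : 'I_n, 0 < nu k 0 ->
     ((u k 0)%:~R%:E - efloor ((zeta - LB) / (nu k 0)%:E)
      <= (xstar k 0)%:~R%:E)%E).
Proof.
have [fx optx] := hopt; have [_ _ nu0 omega0] := hdual.
have gap : ((\sum_i (omega i 0 * (xstar i 0 - l i 0)%:~R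
    + nu i 0 * (u i 0 - xstar i 0)%:~R))%:E <= zeta - LB)%E.
  (* The comparison stays in the extended reals, so [LB] may be -oo. *)
  apply: le_trans (weak_duality hl fx hdual) _; rewrite hzeta leeD2l// leeN2.
  by case: hLB => y fy ->; apply: optx.
have xl i : 0 <= omega i 0 * (xstar i 0 - l i 0)%:~R.
  by rewrite mulr_ge0// ler0z subr_ge0; case/andP: (fx.2 i).
have ux i : 0 <= nu i 0 * (u i 0 - xstar i 0)%:~R.
  by rewrite mulr_ge0// ler0z subr_ge0; case/andP: (fx.2 i).
have term k : omega k 0 * (xstar k 0 - l k 0)%:~R
      + nu k 0 * (u k 0 - xstar k 0)%:~R
    <= \sum_i (omega i 0 * (xstar i 0 - l i 0)%:~R
               + nu i 0 * (u i 0 - xstar i 0)%:~R).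
  by rewrite (bigD1 k)//= lerDl sumr_ge0// => i _; rewrite addr_ge0.
split=> k wk.
(* Of the k-th summand only the [omega] half is kept; the [nu] half is nonnegative. The second bound
   swaps the roles. *)
- have : ((xstar k 0 - l k 0)%:~R%:E
          <= efloor ((zeta - LB) / (omega k 0)%:E))%E.
    apply: le_efloor_div => //; apply: le_trans gap; rewrite lee_fin.
    by apply: le_trans (term k); rewrite lerDl.
  move=> /(leeD2l (l k 0)%:~R%:E) h. apply: le_trans _ h.
  by rewrite -EFinD -intrD subrKC.
- have : ((u k 0 - xstar k 0)%:~R%:E
          <= efloor ((zeta - LB) / (nu k 0)%:E))%E.
    apply: le_efloor_div => //; apply: le_trans gap; rewrite lee_fin.
    by apply: le_trans (term k); rewrite lerDr.
  (* Subtracting from [u k 0] reverses the inequality, and u_k - (u_k - x_k) = x_k. *)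
  move=> /(leeB (lexx (u k 0)%:~R%:E)) /le_trans; apply.
  by rewrite -EFinB -intrB subKr.
Qed.
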